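(* Let $x\in(0,1)$ and let $\nu$ be a finite positive Borel measure on $(0,1)$. Let $$\mathcal A_\nu=\{u\in C([0,1]):u\text{ is convex and }u''\ge\nu\}$$ with $u''\ge\nu$ in the sense of distributions on $(0,1)$, and let $\mu_x=(1-x)\delta_0+x\delta_1$. Then $$B_\nu(x,\mu_x)=\int_0^1G(x,t)\,d\nu(t),$$ where $$G(x,t)=\begin{cases}t(1-x),&t\le x,\\ x(1-t),&x\le t.\end{cases}$$
   Context: With $\Omega=(0,1)$ and $\partial\Omega=\{0,1\}$, the Jensen deficit is $$B_\nu(x,\mu)=\inf_{u\in\mathcal A_\nu}\Big(\int_{\partial\Omega}u\,d\mu-u(x)\Big),$$ so that $B_\nu(x,\mu_x)=\inf_{u\in\mathcal A_\nu}\big((1-x)u(0)+x\,u(1)-u(x)\big)$. *)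

(* Defs.v *)
From HB Require Import structures.
From mathcomp Require Import all_boot all_order all_algebra.
From mathcomp Require Import interval_inference.
From mathcomp Require Import all_classical all_reals all_analysis.

Set Implicit Arguments.
Unset Strict Implicit.
Unset Printing Implicit Defensive.

Import Order.TTheory GRing.Theory Num.Theory.
Import numFieldNormedType.Exports.

Local Open Scope classical_set_scope.
Local Open Scope ring_scope.

Definition test_function (R : realType) (phi : R -> R) : Prop :=
  [/\ forall (n : nat) (t : R), derivable (phi^`(n))%classic t 1,
      compact (closure [set t | phi t != 0]) &
      closure [set t | phi t != 0] `<=` `]0, 1[].

Definition second_derivative_pairing (R : realType) (u phi : R -> R) : \bar R :=
  (\int[lebesgue_measure]_(t in `]0%R, 1%R[) (u t * (phi^`(2))%classic t)%:E)%E.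

(* A finite Borel measure nu on (0,1) is represented by a Borel measure on R
   vanishing outside (0,1). *)
Definition second_derivative_ge (R : realType) (u : R -> R)
    (nu : {finite_measure set (measurableTypeR R) -> \bar R}) : Prop :=
  forall phi : R -> R, test_function phi -> (forall t, 0 <= phi t) ->
    (\int[nu]_(t in `]0%R, 1%R[) (phi t)%:E
       <= second_derivative_pairing u phi)%E.

(* An element of C([0,1]) is represented by an arbitrary extension of it to R;
   membership does not depend on the values taken outside [0,1]. *)
Definition admissible (R : realType)
    (nu : {finite_measure set (measurableTypeR R) -> \bar R}) : set (R -> R) :=
  [set u : R -> R | [/\ {within `[0, 1], continuous u},
                     convex_function (`[0, 1]%classic : set R^o) u &
                     second_derivative_ge u nu]].

Definition jensen_deficit (R : realType)
    (nu : {finite_measure set (measurableTypeR R) -> \bar R}) (x : R)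
    (mu : {measure set (measurableTypeR R) -> \bar R}) : \bar R :=
  ereal_inf [set (\int[mu]_(y in [set 0%R; 1%R]) (u y)%:E - (u x)%:E)%E
            | u in admissible nu].

Definition barycentric_measure (R : realType) (x : {i01 R})
    : {measure set (measurableTypeR R) -> \bar R} :=
  measure_add (mscale (1 - x%:num)%:nng \d_(0 : measurableTypeR R))
              (mscale (x%:num)%:nng \d_(1 : measurableTypeR R)).

Definition green (R : realType) (x t : R) : R :=
  if t <= x then t * (1 - x) else x * (1 - t).

(* Main.v *)
Require Import Defs.
From HB Require Import structures.
From mathcomp Require Import all_boot all_order all_algebra.
From mathcomp Require Import interval_inference.
From mathcomp Require Import all_classical all_reals all_analysis.
From mathcomp Require Import measurable_realfun ring lra.

Set Implicit Arguments.
Unset Strict Implicit.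
Unset Printing Implicit Defensive.

Import Order.TTheory GRing.Theory Num.Theory.
Import numFieldNormedType.Exports.

Local Open Scope classical_set_scope.
Local Open Scope ring_scope.

(* The Green potential [- \int G(., t) dnu(t)] is admissible, vanishes at [0]
   and [1], and its second derivative is exactly [nu] (by Fubini and
   [\int G(y, t) phi''(y) dy = - phi t]); it therefore gives the upper bound.
   For any admissible [u], the difference [w] of [u] and the potential satisfies
   [w'' >= 0] weakly. Testing against a smooth nonnegative [phi] with [phi'']
   close to [(1 - x) \d_0 + x \d_1 - \d_x] shows that [w x] is at most the chord
   value [(1 - x) * w 0 + x * w 1], which is the lower bound. *)

(** * Smooth functions on the line and the flat functions built from [exp (-1/t)] *)

Section smooth.
Context {R : realType}.
Implicit Types (f g : R -> R) (n : nat).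

(** Recursing on the derivative lets the closure properties below go by induction on [n]. Index [0]
    already asks for one derivative, so index [n] means [n + 1] of them. *)
Fixpoint differentiable_upto n f : Prop :=
  (forall t, derivable f t 1) /\
  (if n is m.+1 then differentiable_upto m f^`()%classic else True).

Definition smooth f := forall n, differentiable_upto n f.

Lemma smooth_derivable_derive1n f : smooth f ->
  forall n t, derivable (f^`(n))%classic t 1.
Proof.
move=> sf n; elim: n f sf => [|n IH] f sf t; first by case: (sf 0).
rewrite /derive1n iterSr; apply: IH => k.
by case: (sf k.+1).
Qed.

Lemma differentiable_uptoW n f :
  differentiable_upto n.+1 f -> differentiable_upto n f.
Proof.
elim: n f => [|n IH] f /= [df d1]; first by split.
by split => //; apply: IH.
Qed.

Lemma is_derive_differentiable_upto f f' n : (forall t : R, is_derive t 1 f (f' t)) ->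
  differentiable_upto n f' -> differentiable_upto n.+1 f.
Proof.
move=> df sf'; split; first by move=> t; case: (df t).
suff -> : f^`()%classic = f' by [].
by apply/funext => t; rewrite derive1E; apply: derive_val.
Qed.

Lemma differentiable_upto_is_derive n f :
  differentiable_upto n f -> forall t : R, is_derive t 1 f (f^`()%classic t).
Proof.
by move=> df t; rewrite derive1E; apply: derivableP; case: n df => [|n] [].
Qed.

Lemma is_derive_smooth f f' : (forall t : R, is_derive t 1 f (f' t)) ->
  smooth f' -> smooth f.
Proof.
move=> df sf' n; apply: differentiable_uptoW.
exact: is_derive_differentiable_upto df (sf' n).
Qed.

Lemma differentiable_uptoD n f g : differentiable_upto n f ->
  differentiable_upto n g -> differentiable_upto n (f \+ g).
Proof.
elim: n f g => [|n IH] f g sf sg.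
  by split=> // t; apply: derivableD; [case: sf | case: sg].
apply: (@is_derive_differentiable_upto _ (f^`() \+ g^`())%classic).
  move=> t; have := differentiable_upto_is_derive sf t.
  have := differentiable_upto_is_derive sg t.
  by move=> *; apply: is_deriveD.
by apply: IH; [case: sf | case: sg].
Qed.

(** The product rule mixes each function with the derivative of the other, so the undifferentiated
    factor has to be weakened by one level before the induction hypothesis applies. *)
Lemma differentiable_uptoM n f g : differentiable_upto n f ->
  differentiable_upto n g -> differentiable_upto n (f \* g).
Proof.
elim: n f g => [|n IH] f g sf sg.
  by split=> // t; apply: derivableM; [case: sf | case: sg].
apply: (@is_derive_differentiable_upto _
    ((f \* g^`()) \+ (g \* f^`()))%classic).
  move=> t; have := differentiable_upto_is_derive sf t.
  have := differentiable_upto_is_derive sg t.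
  by move=> *; apply: is_deriveM.
apply: differentiable_uptoD; apply: IH; first exact: differentiable_uptoW.
- by case: sg.
- exact: differentiable_uptoW.
- by case: sf.
Qed.

Lemma is_derive_affine f (df c d : R) (t : R) : is_derive (c * t + d) 1 f df ->
  is_derive t 1 (fun s => f (c * s + d)) (c * df).
Proof.
move=> dfx.
have := @is_derive1_comp R f (fun s => c * s + d) t df c dfx.
rewrite mulrC; apply.
by apply: is_derive_eq; rewrite addr0 /GRing.scale/= mulr1.
Qed.

Lemma differentiable_upto_cst n (c : R) : differentiable_upto n (cst c).
Proof.
elim: n c => [|n IH] c; first by split=> // t; exact: derivable_cst.
by apply: (@is_derive_differentiable_upto _ (cst 0)) => // t; exact: is_derive_cst.
Qed.

Lemma differentiable_upto_affine n f (c d : R) : differentiable_upto n f ->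
  differentiable_upto n (fun s => f (c * s + d)).
Proof.
elim: n f => [|n IH] f sf.
  split => // t; have := differentiable_upto_is_derive sf (c * t + d).
  by move=> /is_derive_affine df; by case: df.
apply: (@is_derive_differentiable_upto _
  (cst c \* (fun s => f^`()%classic (c * s + d)))).
  by move=> t; apply/is_derive_affine/differentiable_upto_is_derive/sf.
apply: differentiable_uptoM; first exact: differentiable_upto_cst.
by apply: IH; case: sf.
Qed.

Lemma smoothD f g : smooth f -> smooth g -> smooth (f \+ g).
Proof. by move=> sf sg n; apply: differentiable_uptoD. Qed.

Lemma smoothM f g : smooth f -> smooth g -> smooth (f \* g).
Proof. by move=> sf sg n; apply: differentiable_uptoM. Qed.

Lemma smooth_affine f (c d : R) : smooth f -> smooth (fun s => f (c * s + d)).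
Proof. by move=> sf n; apply: differentiable_upto_affine. Qed.

Lemma smooth_cst (c : R) : smooth (cst c).
Proof. by move=> n; apply: differentiable_upto_cst. Qed.

Lemma smooth_continuous f : smooth f -> continuous f.
Proof.
by move=> /(_ 0%N)[df _] t; apply/differentiable_continuous/derivable1_diffP.
Qed.

(* The derivatives of [exp (-1/t)], extended by [0], are [p (1/t) exp (-1/t)]
   for polynomials [p]. *)
Definition flat (p : {poly R}) (t : R) : R :=
  if 0 < t then p.[t^-1] * expR (- t^-1) else 0.

(** Exponential decay beats every power of [1/t]. The linear bound is what makes all difference
    quotients at [0] tend to [0]. *)
Lemma flat_le_linear (p : {poly R}) :
  exists C, forall t, `|flat p t| <= C * `|t|.
Proof.
(* An extra factor ['X^n] is generalized: the Horner step turns [(p * 'X + c) * 'X^n] into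
   [p * 'X^(n+1)], covered by induction, plus a monomial. *)
rewrite -[p]mulr1 -(expr0 'X); move: 0%N => n.
elim/poly_ind: p n => [|p c IH] n.
  by exists 0 => t; rewrite mul0r /flat mul0r horner0 mul0r if_same normr0.
have [C HC] := IH n.+1.
exists (C + `|c| * n.+1`!%:R) => t.
rewrite mulrDl -mulrA -exprS.
have -> : flat (p * 'X^(n.+1) + c%:P * 'X^n) t =
    flat (p * 'X^(n.+1)) t + flat (c%:P * 'X^n) t.
  by rewrite /flat; case: ifP => _; rewrite ?addr0// hornerD mulrDl.
rewrite mulrDl; apply: (le_trans (ler_normD _ _)); apply: lerD => //.
rewrite /flat; case: ifPn => [t0|_]; last first.
  by rewrite normr0 mulr_ge0// mulr_ge0// ler0n.
rewrite hornerM hornerC hornerXn -!mulrA normrM ler_wpM2l//.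
rewrite ger0_norm; last by rewrite mulr_ge0 ?expR_ge0// exprn_ge0// invr_ge0 ltW.
rewrite gtr0_norm// expRN ler_pdivrMr ?expR_gt0//.
(* The term of degree [n + 1] in the series of [exp (1/t)] is one degree higher than the monomial,
   which leaves a spare factor [t]. *)
have := @expR_ge1Dxn R t^-1 n (ltW _); rewrite invr_gt0 => /(_ t0).
set e := expR _ => He.
have {}He : t^-1 ^+ n.+1 / n.+1`!%:R <= e by apply: le_trans He; rewrite lerDr ler01.
move: He; rewrite ler_pdivrMr ?ltr0n ?fact_gt0// => He.
have := ler_wpM2r (ltW t0) He; rewrite exprSr -mulrA mulVf ?gt_eqF// mulr1.
by move=> /le_trans; apply; rewrite [leRHS]mulrC mulrA.
Qed.

(** With [s = 1/t] one has [ds/dt = - s^2], so [p(s) exp(-s)] has derivative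
    [s^2 (p - p')(s) exp(-s)]: the family is closed under differentiation. *)
Lemma is_derive_flat (p : {poly R}) (t : R) :
  is_derive t 1 (flat p) (flat ('X^2 * (p - p^`())) t).
Proof.
have [t0|t0|->] := ltrgtP t 0.
- apply: (@near_eq_is_derive _ _ _ (cst 0)).
  + near=> s; rewrite /flat ltNge ltW//=.
    by near: s; exact: lt_nbhsl.
  + by rewrite {1}/flat ltNge ltW//=; exact: is_derive_cst.
- apply: (@near_eq_is_derive R R R (fun s : R => p.[s^-1] * expR (- s^-1))).
  + near=> s; rewrite /flat ifT//.
    by near: s; exact: lt_nbhsr.
  + have dV : is_derive t 1 (fun s : R => s^-1) (- t ^- 2 *: 1).
      by apply: is_deriveV; rewrite gt_eqF.
    have dp : is_derive t 1 (fun s : R => p.[s^-1]) (p^`().[t^-1] * (- t ^- 2 *: 1)).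
      exact: (@is_derive1_comp R (horner p) (fun s : R => s^-1)).
    have dN : is_derive t 1 (fun s : R => - s^-1) (t ^- 2).
      by apply: is_derive_eq; rewrite /GRing.scale/= mulr1 opprK.
    have de : is_derive t 1 (fun s : R => expR (- s^-1)) (expR (- t^-1) * t ^- 2).
      exact: (@is_derive1_comp R expR (fun s : R => - s^-1)).
    apply: is_derive_eq; rewrite /flat t0 !hornerE /GRing.scale/= mulr1.
    by rewrite exprVn; ring.
(* The slope function at [0] is [flat ('X * p)], since dividing by [t] multiplies by [1/t]; the
   linear bound makes it continuous there with value [0]. *)
- apply/is_derive1_caratheodory; exists (flat ('X * p)); split.
  + move=> z; rewrite /flat ltxx !subr0 hornerM hornerX.
    case: ifPn => z0; last by rewrite mul0r.
    by rewrite [RHS]mulrC !mulrA divff ?gt_eqF// mul1r.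
  + have [C HC] := flat_le_linear ('X * p).
    have f0 : flat ('X * p) 0 = 0 by rewrite /flat ltxx.
    rewrite /prop_for /continuous_at f0.
    apply/cvgr0Pnorm_le => e e0; near=> s.
    apply: (le_trans (HC s)).
    have C0 : C <= `|C| + 1 by rewrite ler_wpDr// ler_norm.
    apply: (le_trans (ler_wpM2r (normr_ge0 s) C0)).
    rewrite mulrC -ler_pdivlMr ?ltr_wpDl//.
    near: s; apply: (@nbhs0_le R R^o); rewrite divr_gt0// ltr_wpDl.
  + by rewrite /flat ltxx.
Unshelve. all: by end_near. Qed.

Lemma smooth_flat (p : {poly R}) : smooth (flat p).
Proof.
move=> n; elim: n p => [|n IH] p; have dp := is_derive_flat p.
  by split=> // t; by case: (dp t).
exact: is_derive_differentiable_upto dp (IH _).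
Qed.

End smooth.

(** * Primitives, bumps and the smooth hinge *)

Section calculus.
Context {R : realType}.
Notation mu := (@lebesgue_measure R).
Implicit Types (f g F : R -> R).

Lemma is_derive_continuous F f : (forall t : R, is_derive t 1 F (f t)) ->
  continuous F.
Proof.
by move=> dF t; apply/differentiable_continuous/derivable1_diffP; case: (dF t).
Qed.

Lemma is_derive_increment F f (a b : R) :
  (forall t : R, is_derive t 1 F (f t)) -> a < b ->
  exists2 c, a < c < b & F b - F a = f c * (b - a).
Proof.
move=> dF ab; have [|c] := @MVT R F f a b ab _ _.
- exact/continuous_subspaceT/is_derive_continuous.
- by rewrite in_itv/= => acb ->; exists c.
Qed.

Lemma is_derive_nondecreasing F f : (forall t : R, is_derive t 1 F (f t)) ->
  (forall t, 0 <= f t) -> {homo F : a b / a <= b}.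
Proof.
move=> dF f0 a b; rewrite le_eqVlt => /predU1P[->//|ab].
have [c _ Fab] := is_derive_increment dF ab.
by rewrite -subr_ge0 Fab mulr_ge0// subr_ge0 ltW.
Qed.

Lemma is_derive0_cst_right F f (d : R) : (forall t : R, is_derive t 1 F (f t)) ->
  (forall t, d <= t -> f t = 0) -> forall t, d <= t -> F t = F d.
Proof.
move=> dF f0 t; rewrite le_eqVlt => /predU1P[->//|dt].
have [c /andP[dc _] Fdt] := is_derive_increment dF dt.
by apply/eqP; rewrite -subr_eq0 Fdt f0 ?mul0r// ltW.
Qed.

Lemma within_continuous_integrable_cc f (a b : R) :
  {within `[a, b], continuous f} -> mu.-integrable `[a, b] (EFin \o f).
Proof. by apply: continuous_compact_integrable; exact: segment_compact. Qed.

Lemma within_continuous_integrable_oo f (a b : R) :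
  {within `[a, b], continuous f} -> mu.-integrable `]a, b[ (EFin \o f).
Proof.
move=> /within_continuous_integrable_cc; apply: integrableS => //.
exact: subset_itv_oo_cc.
Qed.

Lemma integral_derivative_cc F f (a b : R) : a <= b ->
  (forall t : R, is_derive t 1 F (f t)) -> continuous f ->
  (\int[mu]_(t in `[a, b]) f t = F b - F a)%R.
Proof.
rewrite le_eqVlt => /predU1P[<-|ab] dF cf.
  by rewrite set_itv1 Rintegral_set1 subrr.
rewrite /Rintegral (@continuous_FTC2 R f F)//.
- exact: continuous_subspaceT.
- have cF := is_derive_continuous dF.
  split; first by move=> t _; case: (dF t).
  + exact/cvg_at_right_filter/cF.
  + exact/cvg_at_left_filter/cF.
- by move=> t _; rewrite derive1E; apply: derive_val.
Qed.

Lemma Rintegral_oo_cc f (a b : R) : {within `[a, b], continuous f} ->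
  (\int[mu]_(t in `]a, b[) f t = \int[mu]_(t in `[a, b]) f t)%R.
Proof.
move=> cf; rewrite Rintegral_itv_obnd_cbnd.
  apply: Rintegral_itv_bndo_bndc.
  apply: integrableS (within_continuous_integrable_cc cf) => //.
  by apply: subset_itvl; rewrite bnd_simp.
exact: within_continuous_integrable_oo.
Qed.

Lemma antiderivative_from_0 g : continuous g -> (forall t, t <= 0 -> g t = 0) ->
  exists G, (forall t : R, is_derive t 1 G (g t)) /\ (forall t, t <= 0 -> G t = 0).
Proof.
(* Integrating from [-1] instead of [0] keeps every [t >= 0] strictly inside the interval of
   integration used by the fundamental theorem; for [t < 0] the primitive is locally zero. *)
move=> cg g0; pose G t := (\int[mu]_(s in `[(-1)%R, t]) g s)%R.
have G0 t : t <= 0 -> G t = 0.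
  move=> t0; rewrite /G (_ : (\int[mu]_(s in `[(-1)%R, t]) g s)%R =
      (\int[mu]_(s in `[(-1)%R, t]) 0)%R); last first.
    apply: eq_Rintegral => s; rewrite inE/= in_itv/= => /andP[_ st].
    by rewrite g0// (le_trans st).
  by rewrite Rintegral_cst// mul0r.
exists G; split => // t; have [t0|t0] := ltP t 0.
  apply: (@near_eq_is_derive R R R (cst 0)).
    near=> s; rewrite G0//.
    by apply: ltW; near: s; exact: lt_nbhsl.
  by rewrite g0 ?ltW//; exact: is_derive_cst.
have [||||dG Gt] := @continuous_FTC1_closed R g (-1) t (t + 1).
- by rewrite ltrDl.
- apply: within_continuous_integrable_cc.
  exact: continuous_subspaceT.
- by rewrite (lt_le_trans _ t0)// ltrN10.
- exact: cg.
by rewrite -Gt derive1E; apply: derivableP.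
Unshelve. all: by end_near. Qed.

Lemma smooth_bump (d : R) : 0 < d -> exists g : R -> R,
  [/\ smooth g, forall t, 0 < t < d -> 0 < g t & forall t, ~~ (0 < t < d) -> g t = 0].
Proof.
(* The bump is [exp (-1/t) * exp (-1/(d - t))] on [(0, d)]. *)
move=> d0; exists (flat 1 \* (fun t => flat 1 (-1 * t + d))); split.
- by apply: smoothM; [|apply: smooth_affine]; exact: smooth_flat.
- move=> t /andP[t0 td]; rewrite /flat/= t0 mulN1r addrC subr_gt0 td.
  by rewrite !hornerC !mul1r mulr_gt0// expR_gt0.
- move=> t; rewrite /flat/= mulN1r addrC subr_gt0.
  by case: (0 < t) => /=; [move=> /negPf ->; rewrite mulr0|rewrite mul0r].
Qed.

(* A smooth convex regularization of [max 0 t], up to a translation. *)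
Lemma smooth_hinge (d : R) : 0 < d -> exists (H h r : R -> R) (c : R),
  [/\ smooth H /\ smooth r,
      (forall t : R, is_derive t 1 H (h t)) /\ (forall t : R, is_derive t 1 h (r t)),
      (forall t, 0 <= r t) /\ (forall t, ~~ (0 < t < d) -> r t = 0),
      forall t, t <= 0 -> H t = 0 /\ h t = 0 &
      forall t, d <= t -> H t = t - c /\ h t = 1].
Proof.
move=> d0; have [r0 [sr0 r0gt r0out]] := smooth_bump d0.
have r0l t : t <= 0 -> r0 t = 0 by move=> t0; rewrite r0out// ltNge t0.
have [h0 [dh0 h0l]] := antiderivative_from_0 (smooth_continuous sr0) r0l.
(* The mean value point lies inside [(0, d)], where the bump is positive. Hence its total mass
   [h0 d] is positive, and dividing by it makes the slope of the hinge reach exactly [1]. *)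
have [c /r0gt rc0 h0d] := is_derive_increment dh0 d0.
have {rc0 h0d}h0d : 0 < h0 d.
  by move: h0d; rewrite (h0l 0)// !subr0 => ->; rewrite mulr_gt0.
pose k := (h0 d)^-1; pose r := cst k \* r0; pose h := cst k \* h0.
have dh t : is_derive t (1 : R) h (r t).
  have := dh0 t => ?.
  by apply: is_derive_eq; rewrite /r /= scaler0 addr0.
have sr : smooth r by apply: smoothM => //; exact: smooth_cst.
have sh : smooth h by exact: is_derive_smooth dh sr.
have hl t : t <= 0 -> h t = 0 by move=> t0; rewrite /h/= h0l// mulr0.
have rr t : ~~ (0 < t < d) -> r t = 0 by move=> ?; rewrite /r/= r0out// mulr0.
have hr t : d <= t -> h t = 1.
  move=> dt; rewrite (is_derive0_cst_right dh _ dt).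
    by rewrite /h/= mulVf// gt_eqF.
  by move=> s ds; apply: rr; rewrite negb_and -!leNgt ds orbT.
have [H [dH Hl]] := antiderivative_from_0 (smooth_continuous sh) hl.
exists H, h, r, (d - H d); split=> //.
- by split=> //; exact: is_derive_smooth dH sh.
- split=> // t; have [td|td] := boolP (0 < t < d).
    by rewrite /r/= mulr_ge0// ?invr_ge0 ltW// r0gt.
  by rewrite rr.
- by move=> t t0; rewrite Hl// hl.
- move=> t dt; split; last exact: hr.
  (* Past [d] the slope is [1], so [H t - t] stays at its value at [d]; this fixes the constant
     [d - H d]. *)
  have dHid s : is_derive s (1 : R) (H \- id) (h s - 1).
    by have := dH s => ?; apply: is_deriveB.
  have := is_derive0_cst_right dHid _ dt => /=.
  have -> // : H t = t - (d - H d) <-> H t - t = H d - d by split; lra.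
  by apply=> s ds; rewrite hr// subrr.
Qed.

End calculus.

(** * Weak convexity implies the chord inequality *)

Section convexity.
Context {R : realType}.
Notation mu := (@lebesgue_measure R).
Implicit Types (f g F H h r phi w : R -> R).

Lemma is_derive_translate f (df a t : R) : is_derive (t - a) 1 f df ->
  is_derive t 1 (fun s => f (s - a)) df.
Proof.
move=> dfx; have : is_derive (1 * t + - a) 1 f df by rewrite mul1r.
move=> /is_derive_affine; rewrite mul1r.
by under eq_fun do rewrite mul1r.
Qed.

Lemma smooth_translate f (a : R) : smooth f -> smooth (fun s => f (s - a)).
Proof.
by move=> /(smooth_affine 1 (- a)); under eq_fun do rewrite mul1r.
Qed.

Lemma derive1n2 f f' f'' : (forall t : R, is_derive t 1 f (f' t)) ->
  (forall t : R, is_derive t 1 f' (f'' t)) -> (f^`(2))%classic = f''.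
Proof.
move=> df df'; rewrite /derive1n/= (_ : f^`()%classic = f').
  by apply/funext => t; rewrite derive1E; apply: derive_val.
by apply/funext => t; rewrite derive1E; apply: derive_val.
Qed.

Lemma is_derive_monotone_tangent H h : (forall t : R, is_derive t 1 H (h t)) ->
  {homo h : s t / s <= t} -> forall p s, H p + h p * (s - p) <= H s.
Proof.
move=> dH hm p s; have [sp|ps|->] := ltrgtP s p; last by rewrite subrr mulr0 addr0.
- have [c /andP[sc cp] Hc] := is_derive_increment dH sp.
  have := ler_wpM2r _ (hm _ _ (ltW cp)) => /(_ (p - s)).
  rewrite subr_ge0 => /(_ (ltW sp)); rewrite -Hc => ?; lra.
- have [c /andP[pc cs] Hc] := is_derive_increment dH ps.
  have := ler_wpM2r _ (hm _ _ (ltW pc)) => /(_ (s - p)).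
  rewrite subr_ge0 => /(_ (ltW ps)); rewrite -Hc => ?; lra.
Qed.

(* A nonnegative test function whose second derivative approximates
   [(1 - x) \d_a + x \d_b - \d_x]. *)
Lemma chord_test_function (x a b d : R) : 0 < x < 1 -> 0 < d -> 0 < a ->
  a <= x -> x <= b -> b + d < 1 -> (1 - x) * a + x * b = x ->
  exists phi r h : R -> R,
  [/\ test_function phi /\ (forall t, 0 <= phi t),
      forall t, (phi^`(2))%classic t = (1 - x) * r (t - a) + x * r (t - b) - r (t - x),
      continuous r /\ (forall t : R, is_derive t 1 h (r t)),
      (forall t, 0 <= r t) /\ (forall t, ~~ (0 < t < d) -> r t = 0) &
      forall t, (t <= 0 -> h t = 0) /\ (d <= t -> h t = 1)].
Proof.
move=> /andP[x0 x1] d0 a0 ax xb bd1 abx.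
have [H [h [r [c [[sH sr] [dH dh] [r0 rout] Hl Hr]]]]] := smooth_hinge d0.
pose comb f t := (1 - x) * f (t - a) + x * f (t - b) - f (t - x).
have dcomb f f' : (forall t : R, is_derive t 1 f (f' t)) ->
    forall t : R, is_derive t 1 (comb f) (comb f' t).
  move=> df t.
  have := is_derive_translate (df (t - a)) => ?.
  have := is_derive_translate (df (t - b)) => ?.
  have := is_derive_translate (df (t - x)) => ?.
  by apply: is_derive_eq; rewrite /comb /GRing.scale/=; ring.
exists (comb H), r, h; split => //.
- split; last first.
    move=> t; have hm := is_derive_nondecreasing dh r0.
    (* Jensen's inequality for the convex [H]: the tangent at [t - x] lies below both values, and
       its linear terms cancel because [x] is the barycentre of [a] and [b]. *)
    have Ha := is_derive_monotone_tangent dH hm (t - x) (t - a).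
    have Hb := is_derive_monotone_tangent dH hm (t - x) (t - b).
    have x1' : 0 <= 1 - x by rewrite subr_ge0 ltW.
    have {}Ha := ler_wpM2l x1' Ha; have {}Hb := ler_wpM2l (ltW x0) Hb.
    rewrite /comb subr_ge0; apply: le_trans (lerD Ha Hb).
    rewrite le_eqVlt; apply/orP; left; apply/eqP.
    suff : h (t - x) * (x - ((1 - x) * a + x * b)) = 0 by move=> E; lra.
    by rewrite abx subrr mulr0.
  (* Left of [a] all three translates vanish. Right of [b + d] all three are affine of slope [1],
     and they cancel since the weights sum to [1] and average [a] and [b] to [x]. *)
  have supp : closure [set t | comb H t != 0] `<=` `[a, b + d].
    rewrite [X in _ `<=` X](closure_id _).1; last exact: interval_closed.
    apply: closure_subset => t /=; rewrite in_itv/= => /eqP Ht.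
    apply/andP; split; rewrite leNgt; apply/negP => tab; apply: Ht; rewrite /comb.
      by rewrite !(fun s s0 => (Hl s s0).1) ?mulr0 ?addr0 ?subr0//; lra.
    rewrite !(fun s s0 => (Hr s s0).1); [|lra..].
    suff : x - ((1 - x) * a + x * b) = 0 by lra.
    by rewrite abx subrr.
  split.
  + apply: smooth_derivable_derive1n.
    have -> : comb H = ((cst (1 - x) \* (fun t => H (t - a))) \+
        (cst x \* (fun t => H (t - b)))) \+ (cst (-1) \* (fun t => H (t - x))).
      by apply/funext => t; rewrite /comb/= mulN1r.
    do 2?apply: smoothD; (apply: smoothM; [exact: smooth_cst|exact: smooth_translate]).
  + apply: subclosed_compact supp; first exact: closed_closure.
    exact: segment_compact.
  + apply: (subset_trans supp) => t /=; rewrite !in_itv/= => /andP[at_ tb].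
    by rewrite (lt_le_trans a0)//= (le_lt_trans tb).
- by rewrite (derive1n2 (dcomb _ _ dH) (dcomb _ _ dh)).
- by split=> //; exact: smooth_continuous.
- by move=> t; split => [/Hl[]|/Hr[]].
Qed.

Lemma within_continuous_near f (A : set R) (p e : R) : {within A, continuous f} ->
  A p -> 0 < e -> exists2 d, 0 < d &
    forall t, A t -> `|t - p| < d -> `|f t - f p| <= e.
Proof.
move=> /subspace_continuousP/(_ p) + Ap e0 => /(_ Ap).
move=> /cvgrPdist_le/(_ e e0)[d /= d0 Hd]; exists d => // t At tp.
by rewrite distrC; apply: Hd => //=; rewrite distrC.
Qed.

(** The endpoints [0] and [1] are moved inwards so that the test function has support in the open
    interval. Contracting towards [x] would lose smallness control less simply than the choice
    [a = eta * x], [b = 1 - eta * (1 - x)], which keeps the barycentre at [x]; [d] is half of the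
    gap left between [b] and [1]. *)
Lemma chord_parameters (x m : R) : 0 < x < 1 -> 0 < m -> exists a b d : R,
  [/\ 0 < d /\ 0 < a, a <= x <= b, a + d < m, 1 - m < b /\ b + d < 1 &
      d < m /\ (1 - x) * a + x * b = x].
Proof.
move=> /andP[x0 x1] m0; pose eta := Num.min m 1 / 2.
have eta0 : 0 < eta by rewrite divr_gt0// lt_min m0 ltr01.
have etam : eta < m by rewrite /eta; case: (leP m 1) => ?; lra.
have eta1 : eta < 1 by rewrite /eta; case: (leP m 1) => ?; lra.
have x1' : 0 < 1 - x by rewrite subr_gt0.
have etax : 0 < eta * x by rewrite mulr_gt0.
have etax' : 0 < eta * (1 - x) by rewrite mulr_gt0.
have ex : eta * x <= x by rewrite ger_pMl// ltW.
have ex' : eta * (1 - x) <= 1 - x by rewrite ger_pMl// ltW.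
by exists (eta * x), (1 - eta * (1 - x)), (eta * (1 - x) / 2); split;
  [split| apply/andP; split| |split|split]; lra.
Qed.

Lemma weakly_convex_le_chord w (x : R) : 0 < x < 1 ->
  {within `[0, 1], continuous w} ->
  (forall phi, test_function phi -> (forall t, 0 <= phi t) ->
    0 <= \int[mu]_(t in `]0%R, 1%R[) (w t * (phi^`(2))%classic t)) ->
  w x <= (1 - x) * w 0 + x * w 1.
Proof.
move=> /[dup] x01 /andP[x0 x1] cw wpos.
apply/ler_addgt0Pr => e e0; pose e2 := e / 2; have e20 : 0 < e2 by rewrite divr_gt0.
have I0 : (`[0, 1]%classic : set R) 0 by rewrite /= in_itv/= lexx ler01.
have I1 : (`[0, 1]%classic : set R) 1 by rewrite /= in_itv/= lexx ler01.
have Ix : (`[0, 1]%classic : set R) x by rewrite /= in_itv/= !ltW.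
have [d0 d0p W0] := within_continuous_near cw I0 e20.
have [d1 d1p W1] := within_continuous_near cw I1 e20.
have [dx dxp Wx] := within_continuous_near cw Ix e20.
pose m := Num.min d0 (Num.min d1 dx).
have m0 : 0 < m by rewrite !lt_min d0p d1p dxp.
have /and3P[md0 md1 mdx] : [&& m <= d0, m <= d1 & m <= dx].
  by rewrite -!le_min lexx.
have [a [b [d [[d_gt0 a_gt0] /andP[ax xb] ad [mb bd] [dm abx]]]]] :=
  chord_parameters x01 m0.
have [phi [r [h [[tphi phi0] phi2 [cr dh] [r0 rout] hv]]]] :=
  chord_test_function x01 d_gt0 a_gt0 ax xb bd abx.
(* On the support of each kernel [w] is within [e2] of the corresponding value. The kernels near [0]
   and [1] enter positively and get upper bounds; the one near [x] enters negatively and gets a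
   lower bound. *)
pose v0 := w 0 + e2; pose v1 := w 1 + e2; pose vx := w x - e2.
pose comb f t := (1 - x) * v0 * f (t - a) + x * v1 * f (t - b) - vx * f (t - x).
have dcomb t : is_derive t (1 : R) (comb h) (comb r t).
  have := is_derive_translate (dh (t - a)) => ?.
  have := is_derive_translate (dh (t - b)) => ?.
  have := is_derive_translate (dh (t - x)) => ?.
  by apply: is_derive_eq; rewrite /comb /GRing.scale/=; ring.
have ctr p : continuous (fun t => r (t - p)).
  move=> t; apply: continuous_comp; last exact: cr.
  by apply: (@cvgB _ R^o); [exact: cvg_id|exact: cvg_cst].
have ckr k p : continuous (fun t => k * r (t - p)).
  by move=> t; apply: cvgM; [exact: cvg_cst|exact: ctr].
have ccomb : continuous (comb r).
  by move=> t; exact: (cvgB (cvgD (ckr _ _ t) (ckr _ _ t)) (ckr _ _ t)).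
(* This increment is the integral of [comb r], which dominates [w * phi''] pointwise on [(0, 1)]. *)
have : 0 <= comb h 1 - comb h 0.
  rewrite -(integral_derivative_cc ler01 dcomb ccomb) -Rintegral_oo_cc; last first.
    exact: continuous_subspaceT.
  apply: (le_trans (wpos phi tphi phi0)); apply: le_Rintegral => //.
  - apply: within_continuous_integrable_oo.
    have c2 : continuous (phi^`(2))%classic.
      rewrite (_ : (phi^`(2))%classic = fun t =>
        (1 - x) * r (t - a) + x * r (t - b) - r (t - x)); last exact/funext.
      by move=> t; exact: (cvgB (cvgD (ckr _ _ t) (ckr _ _ t)) (ctr _ t)).
    by move=> t; exact: (cvgM (cw t) (continuous_subspaceT c2 (x := t))).
  - apply: within_continuous_integrable_oo; exact: continuous_subspaceT.
  - move=> t tI; have /andP[t0 t1] : 0 < t < 1 by move: tI; rewrite /= in_itv.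
    rewrite phi2 /comb.
    have It : (`[0, 1]%classic : set R) t by rewrite /= in_itv/= !ltW.
    (* Off [(q, q + d)] the kernel [r (t - q)] is zero, so closeness of [t] to [p] matters only on
       that interval. *)
    have bnd (p q k : R) : (0 < t - q < d -> `|t - p| < k) ->
        (forall s, (`[0, 1]%classic : set R) s -> `|s - p| < k -> `|w s - w p| <= e2) ->
        `|w t - w p| * r (t - q) <= e2 * r (t - q).
      move=> tk Wp; have [tq|tq] := boolP (0 < t - q < d); last first.
        by rewrite rout// !mulr0.
      by rewrite ler_wpM2r//; apply: Wp => //; exact: tk.
    have B0 : (w t - w 0) * r (t - a) <= e2 * r (t - a).
      apply: le_trans (bnd 0 a d0 _ W0); first by rewrite ler_wpM2r// ler_norm.
      by move=> /andP[? ?]; rewrite ltr_norml; apply/andP; split; lra.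
    have B1 : (w t - w 1) * r (t - b) <= e2 * r (t - b).
      apply: le_trans (bnd 1 b d1 _ W1); first by rewrite ler_wpM2r// ler_norm.
      by move=> /andP[? ?]; rewrite ltr_norml; apply/andP; split; lra.
    have Bx : (w x - w t) * r (t - x) <= e2 * r (t - x).
      apply: le_trans (bnd x x dx _ Wx).
        by rewrite ler_wpM2r// distrC ler_norm.
      by move=> /andP[? ?]; rewrite ltr_norml; apply/andP; split; lra.
    have x1' : 0 <= 1 - x by rewrite subr_ge0 ltW.
    have {}B0 := ler_wpM2l x1' B0; have {}B1 := ler_wpM2l (ltW x0) B1.
    rewrite /v0 /v1 /vx; lra.
(* Each translate of [h] climbs from [0] to [1] across the unit interval, so the increment equals
   [(1 - x) * v0 + x * v1 - vx], the chord gap of [w] plus [2 * e2 = e]. *)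
have h1 p : p + d <= 1 -> h (1 - p) = 1 by move=> ?; apply: (hv _).2; lra.
have h0 p : 0 <= p -> h (0 - p) = 0 by move=> ?; apply: (hv _).1; lra.
rewrite /comb !h1; [|lra..]; rewrite !h0; [|lra..].
by rewrite !mulr0 !mulr1 /v0 /v1 /vx /e2; lra.
Qed.

End convexity.

(** * The Green function and its pairing with test functions *)

Section green_potential.
Context {R : realType}.
Notation mu := (@lebesgue_measure R).
Notation I := (`]0%R, 1%R[%classic : set (measurableTypeR R)).
Implicit Types (f g phi u : R -> R).

Lemma lipschitz_continuous f (C : R) :
  (forall y z, `|f y - f z| <= C * `|y - z|) -> continuous f.
Proof.
move=> fC y; apply/cvgrPdist_le => e e0; near=> z.
have C0 : C <= `|C| + 1 by rewrite ler_wpDr// ler_norm.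
apply: (le_trans (fC y z)); apply: (le_trans (ler_wpM2r (normr_ge0 _) C0)).
rewrite mulrC -ler_pdivlMr ?ltr_wpDl//.
near: z; apply: (@cvgr_dist_le _ R^o _ _ _ id); first exact: cvg_id.
by rewrite divr_gt0// ltr_wpDl.
Unshelve. all: by end_near. Qed.

(** This form makes symmetry, Lipschitz bounds, concavity and joint measurability easy to read
    off. *)
Lemma green_min (x t : R) : green x t = Num.min x t - x * t.
Proof. by rewrite /green; case: (leP t x) => _; ring. Qed.

Lemma green_sym (x t : R) : green x t = green t x.
Proof. by rewrite !green_min minC mulrC. Qed.

Lemma green_lipschitz (t y z : R) :
  `|green y t - green z t| <= (1 + `|t|) * `|y - z|.
Proof.
rewrite !green_min (_ : _ - _ = (Num.min y t - Num.min z t) - (y - z) * t); last ring.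
rewrite [leRHS]mulrDl mul1r; apply: (le_trans (ler_normB _ _)); apply: lerD.
  by case: (leP y t) => ?; case: (leP z t) => ?; case: (lerP y z) => ?;
    rewrite ?ler_norml; lra.
by rewrite normrM mulrC.
Qed.

Lemma green_continuous (t : R) : continuous (fun y => green y t).
Proof. exact: lipschitz_continuous (green_lipschitz t). Qed.

Lemma green_norm_le (y t : R) : I t -> `|green y t| <= 1 + `|y|.
Proof.
rewrite /= in_itv/= => /andP[t0 t1]; rewrite /green; case: ifPn => _.
  rewrite normrM (ger0_norm (ltW t0)); apply: (@le_trans _ _ (1 * `|1 - y|)).
    by rewrite ler_wpM2r// ltW.
  by rewrite mul1r (le_trans (ler_normB _ _))// normr1.
rewrite normrM ler_wpDl// ler_piMr// ger0_norm; lra.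
Qed.

Lemma bounded_measurable_integrable d (T : measurableType d)
    (m : {measure set T -> \bar R}) (A : set T) (f : T -> R) (C : R) :
  measurable A -> (m A < +oo)%E -> measurable_fun A f ->
  (forall t, A t -> `|f t| <= C) -> m.-integrable A (EFin \o f).
Proof.
move=> mA Afin mf fC; apply: measurable_bounded_integrable => //.
exists C; split; first exact: num_real.
by move=> M CM t At; exact: le_trans (fC t At) (ltW CM).
Qed.

Lemma continuous_segment_bounded f (a b : R) : {within `[a, b], continuous f} ->
  exists C, forall t, a <= t <= b -> `|f t| <= C.
Proof.
move=> cf; have [M [_ HM]] := compact_bounded
  (continuous_compact cf (@segment_compact R a b)).
exists (M + 1) => t tab; apply: (HM (M + 1)); first by rewrite ltrDl.
by exists t => //=; rewrite in_itv.
Qed.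

Lemma test_function_derive1n phi n : test_function phi ->
  forall t : R, is_derive t 1 (phi^`(n))%classic ((phi^`(n.+1))%classic t).
Proof. by move=> [dphi _ _] t; rewrite derive1nS derive1E; exact: derivableP. Qed.

Lemma test_function_derive1n_continuous phi n : test_function phi ->
  continuous (phi^`(n))%classic.
Proof. by move=> tphi; exact: is_derive_continuous (test_function_derive1n n tphi). Qed.

(** The complement of the support is open, so [phi] is zero on a whole neighbourhood of [t]; this
    also kills its derivative. *)
Lemma test_function_vanish phi (t : R) : test_function phi -> ~~ (0 < t < 1) ->
  phi t = 0 /\ phi^`()%classic t = 0.
Proof.
move=> [_ _ supp] t01.
have nt : ~ closure [set s | phi s != 0] t.
  by move=> /supp; rewrite /= in_itv/=; exact/negP.
have phi0 : \forall s \near t, phi s = 0.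
  have : (~` closure [set s | phi s != 0]) t by [].
  rewrite -interiorC => /nbhs_interior; apply: filterS => s.
  by move=> /interior_subset/= /negP; rewrite negbK => /eqP.
split; first exact: nbhs_singleton phi0.
have : is_derive t (1 : R) phi 0.
  apply: (@near_eq_is_derive R R R (cst 0)) => //.
  by apply: filterS phi0 => s ->.
by move=> ?; rewrite derive1E derive_val.
Qed.

(** Two integrations by parts on each side of the kink at [t]: weakly, the Green function has second
    derivative [- \d_t]. *)
Lemma green_representation phi (t : R) : test_function phi -> 0 < t < 1 ->
  \int[mu]_(y in I) (green y t * (phi^`(2))%classic y) = - phi t.
Proof.
move=> tphi /andP[t0 t1].
have c2 := test_function_derive1n_continuous (n := 2) tphi.
have d0 y : is_derive y (1 : R) phi (phi^`()%classic y) :=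
  test_function_derive1n 0 tphi y.
have d1 y : is_derive y (1 : R) phi^`()%classic ((phi^`(2))%classic y) :=
  test_function_derive1n 1 tphi y.
pose p1 := phi^`()%classic; pose p2 := (phi^`(2))%classic.
have cg : continuous (fun y => green y t * p2 y).
  by move=> y; apply: cvgM; [exact: green_continuous|exact: c2].
rewrite Rintegral_oo_cc; last exact: continuous_subspaceT.
have split_t := @Rintegral_itvB R (fun y => green y t * p2 y) (BLeft 0) (BRight 1) t.
have {}split_t := split_t (within_continuous_integrable_cc (continuous_subspaceT cg)).
rewrite !bnd_simp in split_t.
have {split_t} /eqP := split_t (ltW t0) (ltW t1); rewrite subr_eq => /eqP ->.
rewrite Rintegral_itv_obnd_cbnd; last first.
  apply: integrableS (within_continuous_integrable_cc (a := t) (b := 1)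
    (continuous_subspaceT cg)) => //.
  by apply: subset_itvr; rewrite bnd_simp.
(* [F] and [G] are primitives of the integrand on [[0, t]] and [[t, 1]]. The terms in [phi'] cancel
   at [t], the terms in [phi] add up to [- phi t], and the ends contribute nothing. *)
pose F y := (1 - t) * (y * p1 y - phi y).
pose G y := t * ((1 - y) * p1 y + phi y).
have dF y : is_derive y (1 : R) F ((1 - t) * y * p2 y).
  have := d0 y => ?; have := d1 y => ?.
  by apply: is_derive_eq; rewrite /GRing.scale /p1 /p2 /derive1n/=; ring.
have dG y : is_derive y (1 : R) G (t * (1 - y) * p2 y).
  have := d0 y => ?; have := d1 y => ?.
  by apply: is_derive_eq; rewrite /GRing.scale /p1 /p2 /derive1n/=; ring.
have cl : continuous (fun y : R => (1 - t) * y).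
  by move=> y; apply: cvgM; [exact: cvg_cst|exact: cvg_id].
have cr : continuous (fun y : R => t * (1 - y)).
  move=> y; apply: cvgM; first exact: cvg_cst.
  by apply: (@cvgB _ R^o); [exact: cvg_cst|exact: cvg_id].
have cF : continuous (fun y : R => (1 - t) * y * p2 y).
  by move=> y; apply: cvgM; [exact: cl|exact: c2].
have cG : continuous (fun y : R => t * (1 - y) * p2 y).
  by move=> y; apply: cvgM; [exact: cr|exact: c2].
rewrite (_ : (\int[mu]_(y in `[t, 1%R]) _)%R = G 1 - G t); last first.
  rewrite -(integral_derivative_cc (ltW t1) dG cG); apply: eq_Rintegral => y.
  by rewrite inE/= in_itv/= => /andP[ty _]; rewrite /green ty.
rewrite (_ : (\int[mu]_(y in `[0%R, t]) _)%R = F t - F 0); last first.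
  rewrite -(integral_derivative_cc (ltW t0) dF cF); apply: eq_Rintegral => y.
  rewrite inE/= in_itv/= => /andP[_ yt]; rewrite green_min min_l//; ring.
have [p00 p10] : phi 0 = 0 /\ p1 0 = 0.
  by apply: test_function_vanish => //; rewrite ltxx.
have [p01 p11] : phi 1 = 0 /\ p1 1 = 0.
  by apply: test_function_vanish => //; rewrite ltxx andbF.
by rewrite /F /G p00 p10 p01 p11; ring.
Qed.

End green_potential.

(** * The Green potential of [nu] and the comparison with admissible functions *)

Section green_potential_measure.
Context {R : realType}.
Variable nu : {finite_measure set (measurableTypeR R) -> \bar R}.
Notation mu := (@lebesgue_measure R).
Notation I := (`]0%R, 1%R[%classic : set (measurableTypeR R)).
Implicit Types (phi u : R -> R).

Let measurable_I : measurable I. Proof. exact: measurable_itv. Qed.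

Let nuI_fin : (nu I < +oo)%E.
Proof. by rewrite -ge0_fin_numE//; exact: fin_num_measure. Qed.

Definition green_potential (y : R) : R := - (\int[nu]_(t in I) green y t)%R.

Lemma green_integrable (y : R) : nu.-integrable I (EFin \o green y).
Proof.
apply: (@bounded_measurable_integrable _ _ _ _ _ _ (1 + `|y|)) => //; last first.
  by move=> t; exact: green_norm_le.
rewrite (_ : green y = fun t => green t y); last first.
  by apply/funext => t; exact: green_sym.
apply: measurable_funTS; apply: continuous_measurable_fun.
exact: green_continuous.
Qed.

Lemma green_potential_continuous : continuous green_potential.
Proof.
(* For [t] in [(0, 1)] the Lipschitz constant [1 + |t|] of the Green function is at most [2],
   uniformly, and [nu] has finite mass. *)
apply: (@lipschitz_continuous _ _ (2 * fine (nu I))) => y z.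
rewrite /green_potential opprK addrC -RintegralB//; [|exact: green_integrable..].
have iB : nu.-integrable I (EFin \o (fun t => green z t - green y t)).
  exact: integrableB (green_integrable z) (green_integrable y).
apply: (le_trans (le_normr_Rintegral _ iB)) => //.
rewrite (_ : 2 * _ * _ = \int[nu]_(t in I) (2 * `|y - z|)); last first.
  by rewrite Rintegral_cst// mulrAC.
apply: le_Rintegral => //.
- exact: integrable_norm.
- apply: (@bounded_measurable_integrable _ _ _ _ _ _ `|2 * `|y - z| |) => //.
- move=> t It; rewrite distrC; apply: (le_trans (green_lipschitz t y z)).
  rewrite ler_wpM2r//; move: It; rewrite /= in_itv/= => /andP[t0 t1].
  by rewrite ger0_norm; lra.
Qed.

(** For fixed [t] the function is a minimum of two affine functions minus a linear one. *)
Lemma green_concave (t y z s : R) : 0 <= s <= 1 ->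
  s * green y t + (1 - s) * green z t <= green (s * y + (1 - s) * z) t.
Proof.
move=> /andP[s0 s1]; rewrite !green_min.
suff : s * Num.min y t + (1 - s) * Num.min z t <= Num.min (s * y + (1 - s) * z) t.
  by move=> ?; lra.
have s1' : 0 <= 1 - s by rewrite subr_ge0.
rewrite le_min; apply/andP; split.
  by apply: lerD; rewrite ler_wpM2l// ge_min lexx.
apply: (@le_trans _ _ (s * t + (1 - s) * t)); last by rewrite -mulrDl; lra.
by apply: lerD; rewrite ler_wpM2l// ge_min lexx orbT.
Qed.

Lemma green_potential_convex (D : set R^o) : convex_function D green_potential.
Proof.
move=> s y z _ _.
have cE (v w : R^o) : conv s v w = s%:num * v + (1 - s%:num) * w := convRE v w s.
rewrite !cE.
set k := s%:num; have k01 : 0 <= k <= 1 by rewrite /k; apply/andP; split.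
rewrite /green_potential !mulrN -opprD lerN2.
have iZ (c w : R) : nu.-integrable I (EFin \o (fun t => c * green w t)).
  exact: integrableZl (green_integrable w).
rewrite -!RintegralZl//; [|exact: green_integrable..].
rewrite -RintegralD//; [|exact: iZ..].
apply: le_Rintegral => //.
- exact: integrableD (iZ _ _) (iZ _ _).
- exact: green_integrable.
- by move=> t _; exact: green_concave.
Qed.

Lemma green_potential_pairing phi : test_function phi ->
  second_derivative_pairing green_potential phi = (\int[nu]_(t in I) (phi t)%:E)%E.
Proof.
move=> tphi; pose p2 := (phi^`(2))%classic.
have c2 : continuous p2 := test_function_derive1n_continuous (n := 2) tphi.
have [C HC] := continuous_segment_bounded (continuous_subspaceT c2) (a := 0) (b := 1).
pose f (z : measurableTypeR R * measurableTypeR R) := - (green z.1 z.2 * p2 z.1).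
pose D : set (measurableTypeR R * measurableTypeR R) := I `*` I.
have mD : measurable D by exact: measurableX.
have muI : (mu I < +oo)%E by rewrite lebesgue_measure_itv/= lte_fin ltr01 ltey.
have mp2 : measurable_fun setT p2 by exact: continuous_measurable_fun.
have mf : measurable_fun setT f.
  rewrite (_ : f = fun z : measurableTypeR R * measurableTypeR R =>
      - ((Num.min z.1 z.2 - z.1 * z.2) * p2 z.1)); last first.
    by apply/funext => z; rewrite /f green_min.
  apply: measurableT_comp => //; apply: measurable_funM.
    apply: measurable_funB; first exact: measurable_minr.
    by apply: measurable_funM.
  exact: measurableT_comp.
(* On the square the Green function is at most [2] and [phi''] is at most [C] in absolute value, and
   the product measure of the square is finite. *)
have intf : (mu \x nu)%E.-integrable D (EFin \o f).
  apply: (@bounded_measurable_integrable _ _ _ _ _ _ (2 * C)) => //.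
  - rewrite (_ : _ D = (mu I * nu I)%E); last exact: product_measure1E.
    by rewrite lte_mul_pinfty// ge0_fin_numE.
  - exact: measurable_funTS.
  - move=> [y t] [/= yI tI]; rewrite normrN normrM ler_pM//.
      apply: (le_trans (green_norm_le _ tI)).
      by move: yI; rewrite in_itv/= => /andP[y0 y1]; rewrite ger0_norm; lra.
    by apply: HC; move: yI; rewrite in_itv/= => /andP[y0 y1]; rewrite !ltW.
(* Fubini is applied on the whole plane to the extension of [f] by zero. The inner integral is the
   potential times [phi''] in one order, and [phi t] by the Green representation in the other. *)
have := Fubini ((integrable_mkcond _ mD).1 intf).
rewrite /second_derivative_pairing [in X in _ -> X = _]integral_mkcond.
rewrite [in X in _ -> _ = X]integral_mkcond => fub.
transitivity (\int[mu]_x \int[nu]_y ((EFin \o f) \_ D) (x, y))%E.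
  apply: eq_integral => y _; rewrite patchE; case: ifPn => yI; last first.
    rewrite integral0_eq// => t _; rewrite patchE in_setX /= (negPf yI)//.
  rewrite (_ : green_potential y * p2 y =
      \int[nu]_(t in I) (- (green y t * p2 y)))%R; last first.
    rewrite /green_potential mulNr mulrC -RintegralZl//; last exact: green_integrable.
    rewrite -mulN1r -RintegralZl//; last first.
      exact: integrableZl (green_integrable y).
    by apply: eq_Rintegral => t _; rewrite mulN1r mulrC.
  have iy : nu.-integrable I (fun t => (- (green y t * p2 y))%:E).
    have := integrableZl measurable_I (- p2 y) (green_integrable y).
    by apply: eq_integrable => // t _ /=; rewrite -EFinM mulNr mulrC.
  rewrite /Rintegral fineK; last exact: integrable_fin_num.
  rewrite integral_mkcond; apply: eq_integral => t _.
  by rewrite !patchE in_setX yI.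
rewrite fub; apply: eq_integral => t _; rewrite patchE; case: ifPn => tI; last first.
  by rewrite integral0_eq// => y _; rewrite patchE in_setX /= (negPf tI) andbF.
have t01 : 0 < t < 1 by move: tI; rewrite inE/= in_itv.
have cg : continuous (fun y => green y t * p2 y).
  by move=> y; apply: cvgM; [exact: green_continuous|exact: c2].
have ig := within_continuous_integrable_oo (continuous_subspaceT cg) (a := 0) (b := 1).
rewrite -[phi t]opprK -(green_representation tphi t01) -mulN1r -RintegralZl//.
have it : mu.-integrable I (fun y => (-1 * (green y t * p2 y))%:E).
  exact: integrableZl ig.
rewrite /Rintegral fineK; last exact: integrable_fin_num.
rewrite [RHS]integral_mkcond; apply: eq_integral => y _.
by rewrite !patchE in_setX tI andbT; case: ifP => // _; rewrite mulN1r.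
Qed.

Lemma green_potential_admissible : admissible nu green_potential.
Proof.
split.
- exact: continuous_subspaceT green_potential_continuous.
- exact: green_potential_convex.
- by move=> phi tphi _; rewrite green_potential_pairing.
Qed.

Lemma green_potential_boundary : green_potential 0 = 0 /\ green_potential 1 = 0.
Proof.
rewrite /green_potential; split; apply/eqP; rewrite oppr_eq0; apply/eqP.
all: rewrite (@eq_Rintegral _ _ _ _ _ (cst 0)) ?Rintegral_cst ?mul0r// => t.
all: rewrite inE/= in_itv/= green_min => /andP[t0 t1].
  by rewrite min_l ?mul0r ?subr0// ltW.
by rewrite min_r ?mul1r ?subrr// ltW.
Qed.

Lemma admissible_le_chord u (x : R) : 0 < x < 1 -> admissible nu u ->
  u x - green_potential x <= (1 - x) * u 0 + x * u 1.
Proof.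
move=> x01 [cu _ du]; pose w y := u y - green_potential y.
have cG : {within `[0, 1], continuous green_potential}.
  exact: continuous_subspaceT green_potential_continuous.
have cw : {within `[0, 1], continuous w} by move=> y; exact: (cvgB (cu y) (cG y)).
have := weakly_convex_le_chord x01 cw _.
rewrite /w; have [-> ->] := green_potential_boundary; rewrite !subr0; apply.
move=> phi tphi phi0.
have c2 : {within `[0, 1], continuous (phi^`(2))%classic}.
  exact/continuous_subspaceT/(test_function_derive1n_continuous (n := 2) tphi).
have iu : mu.-integrable I (EFin \o (fun t => u t * (phi^`(2))%classic t)).
  by apply: within_continuous_integrable_oo => y; exact: (cvgM (cu y) (c2 y)).
have iG : mu.-integrable I
    (EFin \o (fun t => green_potential t * (phi^`(2))%classic t)).
  by apply: within_continuous_integrable_oo => y; exact: (cvgM (cG y) (c2 y)).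
(* Both pairings are finite, so the claim is the inequality [u'' >= nu] tested on [phi], with
   [\int phi dnu] rewritten as the pairing of the potential. *)
under eq_Rintegral => t _ do rewrite mulrBl.
rewrite RintegralB// subr_ge0 -lee_fin /Rintegral !fineK.
- have := du phi tphi phi0.
  by rewrite -(green_potential_pairing tphi).
- exact: integrable_fin_num.
- exact: integrable_fin_num.
Qed.

End green_potential_measure.

(** * Integration against the two-point measure, and the formula for the deficit *)

Lemma integral_barycentric_measure (R : realType) (x : {i01 R}) (u : R -> R) :
  (\int[barycentric_measure x]_(y in [set 0%R; 1%R]) (u y)%:E =
   ((1 - x%:num) * u 0 + x%:num * u 1)%:E)%E.
Proof.
pose D : set (measurableTypeR R) := [set 0%R; 1%R].
have mD : measurable D by apply: measurableU; exact: measurable_set1.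
(* [u] is arbitrary away from [0] and [1], where it agrees with the affine [v]. *)
pose v (y : measurableTypeR R) := u 0 + (u 1 - u 0) * y.
have mv : measurable_fun D v.
  apply: measurable_funTS; apply: measurable_funD => //.
transitivity (\int[barycentric_measure x]_(y in D) (v y)%:E)%E.
  apply: eq_integral => y; rewrite inE/= => -[]->; rewrite /v.
    by rewrite mulr0 addr0.
  by rewrite mulr1 addrC subrK.
have mEv : measurable_fun D (EFin \o v) by exact/measurable_EFinP.
(* Additivity in the measure is used for nonnegative integrands; the signed [v] is then recovered
   from its positive and negative parts. *)
have ge0 (f : measurableTypeR R -> \bar R) : measurable_fun D f ->
    (forall y, D y -> (0 <= f y)%E) ->
    (\int[barycentric_measure x]_(y in D) f y =
      (1 - x%:num)%:E * f 0%R + x%:num%:E * f 1%R)%E.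
  move=> mf f0; rewrite ge0_integral_measure_add// !ge0_integral_mscale//.
  by rewrite !integral_dirac// !diracE !mem_set ?mul1e//; [right|left].
rewrite integralE (ge0 _ (measurable_funepos mEv)) // (ge0 _ (measurable_funeneg mEv)) //.
have v0 : v 0 = u 0 by rewrite /v mulr0 addr0.
have v1 : v 1 = u 1 by rewrite /v mulr1 addrC subrK.
have maxN (r : R) : Num.max r 0 - Num.max (- r) 0 = r.
  by case: (leP r 0) => ?; case: (leP (- r) 0) => ?; lra.
rewrite !funeposE !funenegE /= v0 v1 -!EFin_max -!EFinM -!EFinD.
congr EFin; rewrite -[in RHS](maxN (u 0)) -[in RHS](maxN (u 1)); ring.
Qed.

Theorem proposition3p1 (R : realType) (x : R) (hx0 : 0 < x) (hx1 : x < 1)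
    (nu : {finite_measure set (measurableTypeR R) -> \bar R})
    (hnu : nu (~` `]0%R, 1%R[) = 0%E) :
  jensen_deficit nu x (barycentric_measure (Itv01 (ltW hx0) (ltW hx1)))
    = (\int[nu]_(t in `]0%R, 1%R[) (green x t)%:E)%E.
Proof.
have -> : (\int[nu]_(t in `]0%R, 1%R[) (green x t)%:E)%E = (- green_potential nu x)%:E.
  rewrite /green_potential opprK /Rintegral fineK//.
  by apply: integrable_fin_num => //; exact: green_integrable.
have x01 : 0 < x < 1 by rewrite hx0.
apply/eqP; rewrite eq_le; apply/andP; split.
(* The potential attains the infimum: its boundary term vanishes, leaving minus its value at [x]. *)
- apply: ereal_inf_lbound; exists (green_potential nu).
    exact: green_potential_admissible.
  rewrite integral_barycentric_measure /=; have [-> ->] := green_potential_boundary nu.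
  by rewrite !mulr0 addr0 -EFinB sub0r.
- apply: le_ereal_inf_tmp => _ [u au <-].
  rewrite integral_barycentric_measure /= -EFinB lee_fin.
  have := admissible_le_chord x01 au; lra.
Qed.
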